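(* Let $\mathbb{F}$ be $\mathbb{R}$ or $\mathbb{C}$. For any $n$ and any $d>3$, $$\mathcal{SON}_3\cap S^d(\mathbb{F}^n)=\mathcal{CON}_3\cap S^d(\mathbb{F}^n)=\{\sigma_1v_1^{\otimes d}+\sigma_2v_2^{\otimes d}+\sigma_3v_3^{\otimes d} : \sigma_k\in\mathbb{F},\ v_k\in\mathbb{F}^n,\ \langle v_k,v_{k'}\rangle=\delta_{k,k'}\},$$ and for $d=3$, $$\mathcal{SON}_3\cap S^3(\mathbb{F}^n)=\{\sigma_1v_1^{\otimes d}+\sigma_2v_2^{\otimes d}+\sigma_3v_3^{\otimes d} : \sigma_k\in\mathbb{F},\ v_k\in\mathbb{F}^n,\ \langle v_k,v_{k'}\rangle=\delta_{k,k'}\}$$ $$\cup\ \{\sigma(v\otimes w\otimes w+w\otimes v\otimes w+w\otimes w\otimes v) : \sigma\in\mathbb{F},\ v,w\in\mathbb{F}^n,\ v\perp w,\ \|v\|=\|w\|=1\}.$$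
   Context: $\delta_{k,k'}$ is the Kronecker delta. Tensors carry the inner product $\langle T,S\rangle=\sum_{i_1,\dots,i_d}T(i_1,\dots,i_d)\overline{S(i_1,\dots,i_d)}$ and norm $\|T\|=\sqrt{\langle T,T\rangle}$ (in particular, vectors do). $S^d(\mathbb{F}^n)$ denotes the tensors in $\mathbb{F}^{n\times\cdots\times n}$ ($d$ factors) invariant under all permutations of the $d$ indices; $v^{\otimes d}$ is the $d$-fold tensor power. Two rank-one tensors $x=x_1\otimes\cdots\otimes x_d$ and $y=y_1\otimes\cdots\otimes y_d$ are: strongly orthogonal if $\langle x,y\rangle=\prod_j\langle x_j,y_j\rangle=0$ and for each $j$ either $\langle x_j,y_j\rangle=0$ or $x_j=\mu_jy_j$ for some non-zero $\mu_j\in\mathbb{F}$; completely orthogonal if $\langle x_j,y_j\rangle=0$ for all $j$. $\mathcal{SON}_r$ and $\mathcal{CON}_r$ (here within $\mathbb{F}^{n\times\cdots\times n}$) are the sets of all tensors (of rank at most $r$) of the form $\sum_{k=1}^r\sigma_k\,v_{k1}\otimes\cdots\otimes v_{kd}$, with $\sigma_k\in\mathbb{F}$, whose terms $v_{k1}\otimes\cdots\otimes v_{kd}$ are pairwise strongly orthogonal, respectively completely orthogonal.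
   Formalization: For n<3 the printed set of sums over three orthonormal vectors is empty, so the equality fails (n=2, e_1^{⊗d}); the formal version takes min(3,n) orthonormal vectors there and reads SON_3, CON_3 as sums of at most 3 terms; for n≥3 it is as printed. *)

(* Defs.v *)
From mathcomp Require Import all_boot all_order all_algebra all_fingroup.
From mathcomp Require Import complex.
From mathcomp Require Import boolp classical_sets reals.

Set Implicit Arguments.
Unset Strict Implicit.
Unset Printing Implicit Defensive.

Import GRing.Theory Num.Theory.

Local Open Scope classical_set_scope.
Local Open Scope ring_scope.

(* [RorC F cj re]: the field F is either the real field R or the complex field
   R[i], with cj its conjugation (the identity on R) and re its real part. *)
Inductive RorC (R : realType) :
    forall F : numFieldType, (F -> F) -> (F -> R) -> Prop :=
| RorC_real : @RorC R R (fun x : R => x) (fun x : R => x)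
| RorC_complex : @RorC R R[i] (@conjc R) (@complex.Re R).

(* F^o, the field as a module over itself, gives tensors their scaling *:. *)
Notation tensor F n d := {ffun {ffun 'I_d -> 'I_n} -> F^o}.

Section Tensors.
Variables (R : realType) (F : numFieldType) (cj : F -> F) (re : F -> R).
Variables (n d : nat).

Implicit Types (u v w : 'rV[F]_n) (x y : 'I_d -> 'rV[F]_n) (T S : tensor F n d).

Definition dot v w : F := \sum_(i < n) v 0 i * cj (w 0 i).

(* <v, v> is a nonnegative real number, so taking its real part loses nothing. *)
Definition vnorm v : R := Num.sqrt (re (dot v v)).

Definition tdot T S : F := \sum_(i : {ffun 'I_d -> 'I_n}) T i * cj (S i).

Definition otimes x : tensor F n d :=
  [ffun i : {ffun 'I_d -> 'I_n} => \prod_(j < d) x j 0 (i j)].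

Definition tpow v : tensor F n d := otimes (fun=> v).

Definition symmetric_tensors : set (tensor F n d) :=
  [set T | forall (s : 'S_d) (i : {ffun 'I_d -> 'I_n}),
     T [ffun j => i (s j)] = T i].

Definition rank_one x : Prop := forall j, x j != 0.

Definition strongly_orthogonal x y : Prop :=
  tdot (otimes x) (otimes y) = 0 /\
  forall j, dot (x j) (y j) = 0 \/
            exists2 mu : F, mu != 0 & x j = mu *: y j.

Definition completely_orthogonal x y : Prop :=
  forall j, dot (x j) (y j) = 0.

(* Sums of at most r terms (hence tensors of rank at most r).  Requiring
   exactly r rank-one terms would differ only when F^n is too small to contain
   r pairwise orthogonal terms, where no sum at all would qualify. *)
Definition orthogonal_sums
    (orth : ('I_d -> 'rV[F]_n) -> ('I_d -> 'rV[F]_n) -> Prop) (r : nat) :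
    set (tensor F n d) :=
  [set T | exists2 s : nat, (s <= r)%N &
     exists (sigma : 'I_s -> F) (x : 'I_s -> 'I_d -> 'rV[F]_n),
       [/\ forall k, rank_one (x k),
           forall k l, k != l -> orth (x k) (x l) &
           T = \sum_(k < s) sigma k *: otimes (x k)]].

Definition SON (r : nat) : set (tensor F n d) :=
  orthogonal_sums strongly_orthogonal r.

Definition CON (r : nat) : set (tensor F n d) :=
  orthogonal_sums completely_orthogonal r.

Definition orthonormal_power_sums (r : nat) : set (tensor F n d) :=
  [set T | exists (sigma : 'I_r -> F) (v : 'I_r -> 'rV[F]_n),
     (forall k l, dot (v k) (v l) = (k == l)%:R) /\
     T = \sum_(k < r) sigma k *: tpow (v k)].

End Tensors.

Section OrderThree.
Variables (R : realType) (F : numFieldType) (cj : F -> F) (re : F -> R).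
Variable n : nat.

Definition otimes3 (a b c : 'rV[F]_n) : tensor F n 3 :=
  otimes (tnth [tuple a; b; c]).

Definition W_tensors : set (tensor F n 3) :=
  [set T | exists (sigma : F) (v w : 'rV[F]_n),
     [/\ dot cj v w = 0, vnorm cj re v = 1, vnorm cj re w = 1 &
         T = sigma *: (otimes3 v w w + otimes3 w v w + otimes3 w w v)]].

End OrderThree.

Arguments symmetric_tensors {F} n d.
Arguments SON {F} cj n d r.
Arguments CON {F} cj n d r.
Arguments orthonormal_power_sums {F} cj n d r.
Arguments W_tensors {R F} cj re n.

(* Main.v *)
(** Testing a tensor against products w_1 ⊗ ... ⊗ w_d turns symmetry into
    invariance of sum_k sigma_k prod_j <x_kj, w_j> under exchanging two of the
    w_j.  If at some mode the factor of the k-th term is orthogonal to the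
    factors of all other terms, this invariance forces the remaining d - 1
    factors of that term to be parallel to each other.  For d > 2 this settles
    completely orthogonal sums.  Consider three strongly orthogonal terms with
    nonzero coefficients.  If at some mode all factors are parallel, T is a
    single power.  If at some mode all factors are orthogonal but at another
    two are parallel, these two terms merge and the sum is completely
    orthogonal.  Otherwise every mode has exactly one odd term out; no term can
    be the odd one at two modes, so d = 3 and T is a W-tensor. *)
Require Import Defs.
From mathcomp Require Import all_boot all_order all_algebra all_fingroup.
From mathcomp Require Import complex.
From mathcomp Require Import ring.
From mathcomp Require Import boolp classical_sets reals.

Set Implicit Arguments.
Unset Strict Implicit.
Unset Printing Implicit Defensive.

Import Order.TTheory GRing.Theory Num.Theory.

Local Open Scope classical_set_scope.
Local Open Scope ring_scope.

(** * Conjugation and the inner product, treated uniformly over the real and complex fields *)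

Section InnerProduct.
Variables (R : realType) (F : numFieldType) (cj : F -> F) (re : F -> R).
Hypothesis hF : RorC cj re.

Lemma cjD : {morph cj : x y / x + y}.
Proof. by case: hF => // x y; rewrite rmorphD. Qed.

Lemma cjM : {morph cj : x y / x * y}.
Proof. by case: hF => // x y; rewrite rmorphM. Qed.

Lemma cj0 : cj 0 = 0.
Proof. by case: hF => //; rewrite rmorph0. Qed.

Lemma cj1 : cj 1 = 1.
Proof. by case: hF => //; rewrite rmorph1. Qed.

Lemma cjK : involutive cj.
Proof. by case: hF => // x; rewrite conjcK. Qed.

Lemma mul_cj_ge0 x : 0 <= x * cj x.
Proof. by case: hF x => [|] x; [exact: sqr_ge0 | exact: mulcJ_ge0]. Qed.

Lemma cj_sum (I : finType) (f : I -> F) : cj (\sum_i f i) = \sum_i cj (f i).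
Proof. exact: (big_morph cj cjD cj0). Qed.

Lemma cj_prod (I : finType) (f : I -> F) : cj (\prod_i f i) = \prod_i cj (f i).
Proof. exact: (big_morph cj cjM cj1). Qed.

Lemma cj_eq0 x : (cj x == 0) = (x == 0).
Proof.
by apply/eqP/eqP => [h|->]; rewrite ?cj0 // -[x]cjK h cj0.
Qed.

Section Dot.
Variable n : nat.
Implicit Types u v w : 'rV[F]_n.
Local Notation "<< v , w >>" := (dot cj v w).

Lemma dotDl u v w : <<u + v, w>> = <<u, w>> + <<v, w>>.
Proof.
by rewrite /dot -big_split; apply: eq_bigr => i _; rewrite mxE mulrDl.
Qed.

Lemma dotZl a v w : <<a *: v, w>> = a * <<v, w>>.
Proof.
by rewrite /dot mulr_sumr; apply: eq_bigr => i _; rewrite mxE mulrA.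
Qed.

Lemma dotC v w : <<v, w>> = cj <<w, v>>.
Proof.
by rewrite /dot cj_sum; apply: eq_bigr => i _; rewrite cjM cjK mulrC.
Qed.

Lemma dotZr a v w : <<v, a *: w>> = cj a * <<v, w>>.
Proof. by rewrite dotC dotZl cjM -dotC. Qed.

Lemma dot0l w : <<0, w>> = 0.
Proof. by rewrite /dot big1 // => i _; rewrite mxE mul0r. Qed.

Lemma dot_eq0C v w : (<<v, w>> == 0) = (<<w, v>> == 0).
Proof. by rewrite dotC cj_eq0. Qed.

Lemma dot_delta v i : <<v, delta_mx 0 i>> = v 0 i.
Proof.
rewrite /dot (bigD1 i) //= mxE !eqxx cj1 mulr1 big1 ?addr0 // => j ji.
by rewrite mxE (negbTE ji) andbF cj0 mulr0.
Qed.

Lemma dot_inj v w : (forall u, <<v, u>> = <<w, u>>) -> v = w.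
Proof. by move=> h; apply/rowP => i; rewrite -!dot_delta h. Qed.

Lemma dotvv_eq0 v : (<<v, v>> == 0) = (v == 0).
Proof.
apply/idP/eqP => [|->]; last by rewrite dot0l.
rewrite psumr_eq0 => [/allP h|i _]; last exact: mul_cj_ge0.
apply/rowP => i; rewrite mxE; apply/eqP.
by have := h i (mem_index_enum i); rewrite mulf_eq0 cj_eq0 orbb.
Qed.

Lemma dotvv_gt0 v : v != 0 -> 0 < <<v, v>>.
Proof.
move=> v0; rewrite lt0r dotvv_eq0 v0.
by apply: sumr_ge0 => i _; exact: mul_cj_ge0.
Qed.

(** The inverse square root of [c] serves. In the complex case [0 < c] forces the imaginary part to
    vanish, so a real square root is available. *)
Lemma unit_scaling c : 0 < c -> exists2 t, t != 0 & t * cj t * c = 1.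
Proof.
case: hF c => [|] c c0.
  have h : Num.sqrt c != 0 by rewrite gt_eqF // sqrtr_gt0.
  exists (Num.sqrt c)^-1; first by rewrite invr_eq0.
  by rewrite -[X in _ * X](@sqr_sqrtr _ c (ltW c0)); field.
case: c c0 => a b; rewrite ltcE /= => /andP[/eqP -> a0].
have h : (Num.sqrt a)%:C%C != 0 by rewrite fmorph_eq0 gt_eqF // sqrtr_gt0.
exists (Num.sqrt a)%:C%C^-1; first by rewrite invr_eq0.
rewrite conjc_inv conjc_real.
have -> : (a +i* 0)%C = (Num.sqrt a)%:C%C ^+ 2.
  by rewrite -rmorphXn /= sqr_sqrtr ?ltW.
by field.
Qed.

Lemma normalize v : v != 0 -> exists2 t, t != 0 & <<t *: v, t *: v>> = 1.
Proof.
move=> /dotvv_gt0/unit_scaling[t t0 h]; exists t => //.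
by rewrite dotZl dotZr mulrA.
Qed.

(** Since [<<v, v>>] is nonnegative, it is real and determined by its real part, which is all that
    [vnorm] sees. *)
Lemma vnorm_eq1 v : (vnorm cj re v == 1) = (<<v, v>> == 1).
Proof.
rewrite /vnorm.
have : 0 <= <<v, v>>.
  by have [->|/dotvv_gt0/ltW//] := eqVneq v 0; rewrite dot0l.
have sqrt1 (x : R) : 0 <= x -> (Num.sqrt x == 1) = (x == 1).
  by move=> x0; rewrite -(@eqr_sqrt _ x 1) ?ler01 // sqrtr1.
move: <<v, v>>; case: hF => [|] c; first exact: sqrt1.
case: c => a b; rewrite lecE /= => /andP[/eqP -> a0].
by rewrite sqrt1 // eq_complex /= eqxx andbT.
Qed.

End Dot.
End InnerProduct.

(** * Proportionality of vectors *)

(** The second alternative of strong orthogonality. The nonzero factor makes it an equivalence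
    relation, with the zero vector parallel only to itself. *)
Definition parallel (F : numFieldType) n (v w : 'rV[F]_n) : Prop :=
  exists2 mu : F, mu != 0 & v = mu *: w.

Section Parallel.
Variables (F : numFieldType) (n : nat).
Implicit Types u v w : 'rV[F]_n.

Lemma parallel_refl v : parallel v v.
Proof. by exists 1; rewrite ?oner_eq0 ?scale1r. Qed.

Lemma parallel_sym v w : parallel v w -> parallel w v.
Proof.
by case=> mu mu0 ->; exists mu^-1; rewrite ?invr_eq0 // scalerA mulVf ?scale1r.
Qed.

Lemma parallel_trans u v w : parallel u v -> parallel v w -> parallel u w.
Proof.
case=> mu mu0 -> [nu nu0 ->]; exists (mu * nu); last by rewrite scalerA.
by rewrite mulf_neq0.
Qed.

End Parallel.

(** * Multilinearity of the tensor product, one factor at a time *)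

Section Update.
Variables (F : numFieldType) (n d : nat).
Implicit Types (u v z : 'rV[F]_n) (x w : 'I_d -> 'rV[F]_n) (i : 'I_d).

Definition upd x i v : 'I_d -> 'rV[F]_n := fun j => if j == i then v else x j.

Lemma upd_same x i v : upd x i v i = v.
Proof. by rewrite /upd eqxx. Qed.

Lemma upd_other x i v j : j != i -> upd x i v j = x j.
Proof. by rewrite /upd => /negbTE ->. Qed.

Lemma otimes_upd x i v (e : {ffun 'I_d -> 'I_n}) :
  otimes (upd x i v) e = v 0 (e i) * \prod_(j | j != i) x j 0 (e j).
Proof.
rewrite ffunE (bigD1 i) //= upd_same; congr (_ * _).
by apply: eq_bigr => j ji; rewrite upd_other.
Qed.

Lemma otimes_updD x i u v :
  otimes (upd x i (u + v)) = otimes (upd x i u) + otimes (upd x i v).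
Proof. by apply/ffunP => e; rewrite [RHS]ffunE !otimes_upd mxE mulrDl. Qed.

Lemma otimes_updZ x i a v :
  otimes (upd x i (a *: v)) = a *: otimes (upd x i v).
Proof. by apply/ffunP => e; rewrite [RHS]ffunE !otimes_upd mxE -mulrA. Qed.

Lemma otimes_ext x y : x =1 y -> otimes x = otimes y.
Proof. by move=> /funext ->. Qed.

Lemma otimes_parallel x y : (forall j, parallel (x j) (y j)) ->
  exists2 c : F, c != 0 & otimes x = c *: otimes y.
Proof.
move=> /(@fin_all_exists2 _ _ _ _)[mu mu0 /= xy].
exists (\prod_j mu j); first by apply/prodf_neq0 => j _; exact: mu0.
apply/ffunP => e; rewrite ffunE [RHS]ffunE [X in _ = _ *: X]ffunE.
transitivity (\prod_j (mu j * y j 0 (e j))); last exact: big_split.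
by apply: eq_bigr => j _; rewrite xy mxE.
Qed.

End Update.

(** * Testing tensors against product tensors *)

Section Form.
Variables (R : realType) (F : numFieldType) (cj : F -> F) (re : F -> R).
Hypothesis hF : RorC cj re.
Variables (n d : nat).
Implicit Types (u v z : 'rV[F]_n) (x y w : 'I_d -> 'rV[F]_n).
Implicit Types (T S : tensor F n d).
Local Notation "<< v , w >>" := (dot cj v w).

Lemma parallel_dot u v (w : 'rV[F]_n) :
  parallel v w -> (<<v, u>> == 0) = (<<w, u>> == 0).
Proof.
by case=> mu /negbTE mu0 ->; rewrite dotZl mulf_eq0 mu0.
Qed.

Lemma parallel_dotr u v (w : 'rV[F]_n) :
  parallel v w -> (<<u, v>> == 0) = (<<u, w>> == 0).
Proof. by move=> vw; rewrite !(dot_eq0C hF u) (parallel_dot _ vw). Qed.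

Lemma dot_parallel_neq0 v (w : 'rV[F]_n) :
  w != 0 -> parallel v w -> <<v, w>> != 0.
Proof. by move=> w0 vw; rewrite (parallel_dot _ vw) (dotvv_eq0 hF). Qed.

Lemma tdot_otimes x w : tdot cj (otimes x) (otimes w) = \prod_j <<x j, w j>>.
Proof.
rewrite /tdot /dot bigA_distr_bigA; apply: eq_bigr => e _.
by rewrite !ffunE (cj_prod hF) -big_split.
Qed.

Lemma tdot_sum (I : finType) (sigma : I -> F) (x : I -> 'I_d -> 'rV[F]_n) S :
  tdot cj (\sum_k sigma k *: otimes (x k)) S
  = \sum_k sigma k * tdot cj (otimes (x k)) S.
Proof.
rewrite /tdot; under eq_bigr do rewrite sum_ffunE mulr_suml.
rewrite exchange_big; apply: eq_bigr => k _; rewrite mulr_sumr.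
by apply: eq_bigr => e _; rewrite ffunE mulrA.
Qed.

(** Products of standard basis vectors already read off every entry. *)
Lemma tdot_inj T S :
  (forall w, tdot cj T (otimes w) = tdot cj S (otimes w)) -> T = S.
Proof.
have tdot_delta T' (e : {ffun 'I_d -> 'I_n}) :
    tdot cj T' (otimes (fun j => delta_mx 0 (e j))) = T' e.
  rewrite /tdot (bigD1 e) //= ffunE big1 ?(cj1 hF) ?mulr1 => [|j _]; last first.
    by rewrite mxE !eqxx.
  rewrite big1 ?addr0 // => f fe; rewrite ffunE.
  suff /existsP[j fej] : [exists j, f j != e j].
    by rewrite (bigD1 j) //= mxE (negbTE fej) andbF mul0r (cj0 hF) mulr0.
  apply: contraNT fe => /existsPn h; apply/eqP/ffunP => j.
  by have := h j; rewrite negbK => /eqP.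
by move=> h; apply/ffunP => e; rewrite -!tdot_delta h.
Qed.

Lemma tdot_perm T w (s : 'S_d) : symmetric_tensors n d T ->
  tdot cj T (otimes (fun j => w (s j))) = tdot cj T (otimes w).
Proof.
move=> symT; pose act (e : {ffun 'I_d -> 'I_n}) := [ffun j => e (s j)].
have act_bij : bijective act.
  exists (fun e : {ffun 'I_d -> 'I_n} => [ffun j => e (s^-1%g j)]) => e.
    by apply/ffunP => j; rewrite !ffunE permKV.
  by apply/ffunP => j; rewrite !ffunE permK.
rewrite /tdot (reindex act) /=; last exact: onW_bij.
apply: eq_bigr => e _; rewrite symT !ffunE; congr (_ * cj _).
rewrite [RHS](reindex_perm s) /=.
by apply: eq_bigr => j _; rewrite ffunE.
Qed.

Lemma tdot_swap T w i i' u z : i != i' -> symmetric_tensors n d T ->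
  tdot cj T (otimes (upd (upd w i' z) i u))
  = tdot cj T (otimes (upd (upd w i' u) i z)).
Proof.
move=> ii' symT; rewrite -(tdot_perm _ (tperm i i') symT).
congr (tdot cj T _); apply: otimes_ext => j; rewrite /upd.
by case: tpermP => [->|->|/eqP/negbTE -> /eqP/negbTE ->] //;
  rewrite ?eqxx // 1?eq_sym (negbTE ii').
Qed.

Lemma tdot_upd2 x w i i' u z : i != i' ->
  tdot cj (otimes x) (otimes (upd (upd w i' z) i u))
  = <<x i, u>> * <<x i', z>> * \prod_(j | (j != i) && (j != i')) <<x j, w j>>.
Proof.
move=> ii'; have i'i : i' != i by rewrite eq_sym.
rewrite tdot_otimes (bigD1 i) //= (bigD1 i') //= mulrA.
rewrite upd_same upd_other // upd_same; congr (_ * _).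
by apply: eq_bigr => j /andP[ji ji']; rewrite !upd_other.
Qed.

(** The working form of symmetry: exchanging the test vectors at [i] and [i'] leaves the
    contribution [rest] of the other modes unchanged. *)
Lemma swap_sum (I : finType) (sigma : I -> F) (x : I -> 'I_d -> 'rV[F]_n)
    w i i' u z (rest := fun k =>
      \prod_(j | (j != i) && (j != i')) <<x k j, w j>>) :
  i != i' -> symmetric_tensors n d (\sum_k sigma k *: otimes (x k)) ->
  \sum_k sigma k * (<<x k i, u>> * <<x k i', z>> * rest k)
  = \sum_k sigma k * (<<x k i, z>> * <<x k i', u>> * rest k).
Proof.
move=> ii' symT; have := tdot_swap w u z ii' symT.
rewrite !tdot_sum.
under eq_bigr do rewrite tdot_upd2 //.
by under [RHS]eq_bigr do rewrite tdot_upd2 //.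
Qed.

Lemma exists_third i i' : (2 < d)%N -> exists2 j : 'I_d, j != i & j != i'.
Proof.
move=> d3; have : (0 < #|~: [set i; i']|)%N.
  rewrite cardsCs finset.setCK card_ord subn_gt0; apply: leq_ltn_trans d3.
  by rewrite cards2; case: eqP.
by case/card_gt0P => j; rewrite !inE negb_or => /andP[]; exists j.
Qed.

(* Testing against the k-th term with one of its factors swapped in for another
   leaves only that term on both sides. *)
Lemma isolated_term_parallel (I : finType) (sigma : I -> F)
    (x : I -> 'I_d -> 'rV[F]_n) (j : 'I_d) (k : I) :
  symmetric_tensors n d (\sum_k sigma k *: otimes (x k)) ->
  sigma k != 0 -> rank_one (x k) ->
  (forall l, l != k -> <<x l j, x k j>> = 0) ->
  forall i i', i != j -> i' != j -> parallel (x k i) (x k i').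
Proof.
move=> symT sk xk isol i i' ij i'j.
have [<-|ii'] := eqVneq i i'; first exact: parallel_refl.
have ji : j != i by rewrite eq_sym.
have ji' : j != i' by rewrite eq_sym.
(* On the left, [x k i'] is tested at mode [i] and a free [u] at mode [i']; all other test vectors
   come from term [k]. *)
have key u : <<x k i, x k i'>> * <<x k i', u>>
    = <<x k i, u>> * <<x k i', x k i'>>.
  have := swap_sum (x k) (x k i') u ii' symT.
  have only_k (f : I -> F) : \sum_l sigma l * (f l *
      \prod_(j | (j != i) && (j != i')) <<x l j, x k j>>)
      = sigma k * (f k *
      \prod_(j | (j != i) && (j != i')) <<x k j, x k j>>).
    rewrite (bigD1 k) //= [X in _ + X]big1 ?addr0 // => l lk.
    (* Mode [j] is among the remaining ones, and its test vector [x k j] kills every other term. *)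
    by rewrite (bigD1 j) ?ji ?ji' //= isol // mul0r !mulr0.
  rewrite !(only_k (fun l => _ * _)) => /(mulfI sk)/mulIf; apply.
  by apply/prodf_neq0 => l _; rewrite (dotvv_eq0 hF) xk.
have /(dot_inj hF) E u :
    << <<x k i, x k i'>> *: x k i', u>> = << <<x k i', x k i'>> *: x k i, u>>.
  by rewrite !dotZl key mulrC.
have n0 : <<x k i', x k i'>> != 0 by rewrite (dotvv_eq0 hF) xk.
have E' : x k i = (<<x k i, x k i'>> / <<x k i', x k i'>>) *: x k i'.
  by rewrite mulrC -scalerA E scalerA mulVf // scale1r.
exists (<<x k i, x k i'>> / <<x k i', x k i'>>) => //.
by apply: contraNneq (xk i) => c0; rewrite E' c0 scale0r.
Qed.

End Form.

(** * Dropping and padding terms, completely orthogonal sums, and sums with a common factor *)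

Section Decompositions.
Variables (R : realType) (F : numFieldType) (cj : F -> F) (re : F -> R).
Hypothesis hF : RorC cj re.
Variable n : nat.
Local Notation "<< v , w >>" := (dot cj v w).

(** Terms with coefficient zero are dropped one by one. Nonzero coefficients are what allows
    cancellation in the swap identities. *)
Lemma nonzero_coefficients d
    (orth : ('I_d -> 'rV[F]_n) -> ('I_d -> 'rV[F]_n) -> Prop) r T :
  orthogonal_sums orth r T ->
  exists2 s, (s <= r)%N & exists (sigma : 'I_s -> F) x,
    [/\ forall k, sigma k != 0, forall k, rank_one (x k),
        forall k l, k != l -> orth (x k) (x l) &
        T = \sum_(k < s) sigma k *: otimes (x k)].
Proof.
case=> s; elim: s => [|s IHs] sr [sigma [x [x1 xo TE]]].
  by exists 0%N => //; exists sigma, x; split=> // -[].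
have [/forallP s0|/forallPn[k]] := boolP [forall k, sigma k != 0].
  by exists s.+1 => //; exists sigma, x.
rewrite negbK => /eqP sk; apply: IHs; first exact: ltnW.
exists (sigma \o lift k), (x \o lift k); split=> [l|l m lm|] /=.
- exact: x1.
- by apply: xo; rewrite (inj_eq lift_inj).
- by rewrite TE (bigD1_ord k) //= sk scale0r add0r.
Qed.

Section Padding.
Variable d : nat.
Implicit Types T : tensor F n d.

(** The matrix with rows [v k] times its conjugate transpose is the identity of size [s], so its
    rank argument bounds [s] by [n]. *)
Lemma orthonormal_size s (v : 'I_s -> 'rV[F]_n) :
  (forall k l, <<v k, v l>> = (k == l)%:R) -> (s <= n)%N.
Proof.
move=> vo; pose V := \matrix_k v k.
apply: (@mulmx1_min F _ _ V (map_mx cj V)^T).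
apply/matrixP => k l; rewrite !mxE -vo.
by apply: eq_bigr => i _; rewrite !mxE.
Qed.

(** The conjugate transpose [A] has only [s < n] columns, so its left kernel contains a nonzero
    vector, which is then normalized. *)
Lemma orthonormal_extend s (v : 'I_s -> 'rV[F]_n) : (s < n)%N ->
  exists u, <<u, u>> = 1 /\ forall k, <<u, v k>> = 0.
Proof.
move=> sn; pose A := (map_mx cj (\matrix_k v k))^T.
have : kermx A != 0.
  by rewrite kermx_eq0 /row_free neq_ltn (leq_ltn_trans (rank_leq_col A) sn).
case/rowV0Pn => u /sub_kermxP uA /(normalize hF)[t _ t1].
exists (t *: u); split=> // k; rewrite dotZl.
have /matrixP/(_ 0 k) := uA; rewrite !mxE => uk.
rewrite (_ : <<u, v k>> = 0) ?mulr0 // -[RHS]uk.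
by apply: eq_bigr => i _; rewrite !mxE.
Qed.

Lemma orthonormal_power_sums_pad s r T : (s <= r <= n)%N ->
  orthonormal_power_sums cj n d s T -> orthonormal_power_sums cj n d r T.
Proof.
case/andP=> sr; elim: r sr => [|r IHr].
  by rewrite leqn0 => /eqP ->.
rewrite leq_eqVlt => /predU1P[-> //|sr rn].
move=> /(IHr sr (ltnW rn))[sigma [v [vo ->]]].
have [u [u1 uo]] := orthonormal_extend v rn.
exists (fun k => oapp sigma 0 (unlift ord0 k)).
exists (fun k => oapp v u (unlift ord0 k)); split=> [k l|].
  case: (unliftP ord0 k) => [k' ->|->];
    case: (unliftP ord0 l) => [l' ->|->] //=.
  by rewrite (dotC hF) uo (cj0 hF).
rewrite big_ord_recl unlift_none scale0r add0r.
by apply: eq_bigr => k _; rewrite liftK.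
Qed.

Lemma tpow_symmetric v : symmetric_tensors n d (tpow d v : tensor F n d).
Proof.
move=> s e; rewrite !ffunE [RHS](reindex_perm s) /=.
by apply: eq_bigr => j _; rewrite ffunE.
Qed.

Lemma power_sum_CON r T : (0 < d)%N ->
  orthonormal_power_sums cj n d r T -> CON cj n d r T.
Proof.
move=> d0 [sigma [v [vo ->]]]; exists r => //; exists sigma, (fun k _ => v k).
split=> // [k j|k l kl j]; last by rewrite vo (negbTE kl).
by rewrite -(dotvv_eq0 hF) vo eqxx oner_eq0.
Qed.

Lemma symmetric_sum (I : finType) (sigma : I -> F) (S : I -> tensor F n d) :
  (forall k, symmetric_tensors n d (S k)) ->
  symmetric_tensors n d (\sum_k sigma k *: S k).
Proof.
move=> symS s e; rewrite !sum_ffunE; apply: eq_bigr => k _.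
by rewrite !ffunE symS.
Qed.

Lemma CON_SON r T : (0 < d)%N -> CON cj n d r T -> SON cj n d r T.
Proof.
move=> d0 [s sr [sigma [x [x1 xo ->]]]]; exists s => //; exists sigma, x.
split=> // k l kl; split=> [|j]; last by left; exact: xo.
by rewrite (tdot_otimes hF) (bigD1 (Ordinal d0)) //= xo // mul0r.
Qed.

(** Under complete orthogonality every mode isolates every term. Any two modes can thus be compared
    by isolating at a third, which is where [2 < d] enters. *)
Lemma CON_symmetric_powers r T : (2 < d)%N ->
  CON cj n d r T -> symmetric_tensors n d T ->
  orthonormal_power_sums cj n d (minn r n) T.
Proof.
move=> d3 /nonzero_coefficients[s sr [sigma [x [s0 x1 xo ->]]]] symT.
pose j0 : 'I_d := Ordinal (ltnW (ltnW d3)).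
have xpar k i i' : parallel (x k i) (x k i').
  have [j ji ji'] := exists_third i i' d3.
  apply: (isolated_term_parallel hF symT (s0 k) (x1 k) (j := j)).
  - by move=> l lk; apply: xo.
  - by rewrite eq_sym.
  - by rewrite eq_sym.
(* For each term, choose a scalar and a unit vector: the factor at mode [j0], normalized, represents
   all factors of the term. *)
have /(fin_all_exists (U := fun=> (F * 'rV[F]_n)%type))[cv cvP] k :
    exists cv : F * 'rV[F]_n, [/\ otimes (x k) = cv.1 *: tpow d cv.2,
      <<cv.2, cv.2>> = 1 & parallel cv.2 (x k j0)].
  have [t t0 t1] := normalize hF (x1 k j0).
  have tpar : parallel (t *: x k j0) (x k j0) by exists t.
  have [c _ xc] : exists2 c, c != 0 & otimes (x k) = c *: tpow d (t *: x k j0).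
    apply: otimes_parallel => j.
    exact: parallel_trans (xpar k j j0) (parallel_sym tpar).
  by exists (c, t *: x k j0).
have vo k l : <<(cv k).2, (cv l).2>> = (k == l)%:R.
  have [_ k1 kpar] := cvP k; have [_ _ lpar] := cvP l.
  have [<- //|kl] := eqVneq k l; apply/eqP.
  by rewrite (parallel_dot _ _ kpar) (parallel_dotr hF _ lpar) (xo _ _ kl).
apply: (@orthonormal_power_sums_pad s).
  by rewrite leq_min sr (orthonormal_size vo) geq_minr.
exists (fun k => sigma k * (cv k).1), (fun k => (cv k).2); split=> //.
by apply: eq_bigr => k _; have [-> _ _] := cvP k; rewrite scalerA.
Qed.

(** No orthogonality is involved: the factor [a] is pulled out at mode [j], symmetry carries this to
    every other mode, and pulling it out everywhere leaves a scalar times the power of [a]. *)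
Lemma common_factor_power (I : finType) (sigma : I -> F)
    (x : I -> 'I_d -> 'rV[F]_n) (j : 'I_d) a
    (T := \sum_k sigma k *: otimes (x k)) :
  symmetric_tensors n d T -> a != 0 -> (forall k, parallel (x k j) a) ->
  exists c, T = c *: tpow d a.
Proof.
move=> symT a0 xa.
have step0 w : <<a, a>> * tdot cj T (otimes w)
    = <<a, w j>> * tdot cj T (otimes (upd w j a)).
  rewrite !(tdot_sum) !mulr_sumr; apply: eq_bigr => k _.
  rewrite !(tdot_otimes hF) (bigD1 j) //= [X in _ = _ * (_ * X)](bigD1 j) //=.
  rewrite upd_same; case: (xa k) => mu _ ->; rewrite !dotZl.
  rewrite [X in _ = _ * (_ * (_ * X))](eq_bigr (fun i => <<x k i, w i>>)).
    by ring.
  by move=> i ij; rewrite upd_other.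
have step i w : <<a, a>> * tdot cj T (otimes w)
    = <<a, w i>> * tdot cj T (otimes (upd w i a)).
  rewrite -(tdot_perm cj w (tperm i j) symT).
  rewrite -(tdot_perm cj (upd w i a) (tperm i j) symT) step0 tpermR.
  congr (_ * tdot cj T _); apply: otimes_ext => l; rewrite /upd.
  suff -> : (tperm i j l == i) = (l == j) by [].
  by rewrite -[X in _ == X](tpermR i j) (inj_eq perm_inj).
(* Without repetitions in [r], each mode is replaced while it still holds its original test vector
   [w i]. *)
have steps (r : seq 'I_d) w : uniq r ->
    <<a, a>> ^+ size r * tdot cj T (otimes w) = (\prod_(i <- r) <<a, w i>>) *
      tdot cj T (otimes (fun i => if i \in r then a else w i)).
  elim: r => [|i r IHr] /=; first by rewrite big_nil.
  case/andP=> ir /IHr E; rewrite big_cons exprS -mulrA E mulrCA (step i).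
  rewrite (negbTE ir) mulrCA mulrA; congr (_ * tdot cj T _).
  by apply: otimes_ext => l; rewrite /upd inE; case: eqP.
exists (tdot cj T (tpow d a) / <<a, a>> ^+ d); apply: (tdot_inj hF) => w.
have aa0 : <<a, a>> ^+ d != 0 by rewrite expf_neq0 // (dotvv_eq0 hF).
have tdotZ c : tdot cj (c *: tpow d a) (otimes w) = c * \prod_i <<a, w i>>.
  rewrite -(tdot_otimes hF (fun=> a)) /tdot mulr_sumr.
  by apply: eq_bigr => e _; rewrite ffunE mulrA.
have := steps (enum 'I_d) w (enum_uniq _).
rewrite size_enum_ord big_enum tdotZ => E; apply: (mulfI aa0); rewrite E.
rewrite (_ : otimes _ = tpow d a); first by field.
by apply: otimes_ext => i; rewrite mem_enum.
Qed.

End Padding.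
End Decompositions.

(** * Three indices, and sums with one odd factor per term *)

Lemma ord3_cover (k l m p : 'I_3) : k != l -> k != m -> l != m ->
  [|| p == k, p == l | p == m].
Proof.
move=> kl km lm; have : ~~ uniq [:: p; k; l; m].
  apply/negP => /card_uniqP /= E.
  by have := max_card (mem [:: p; k; l; m]); rewrite E card_ord.
by rewrite /= !inE !negb_or kl km lm !andbT !negb_and !negbK.
Qed.

Lemma sum_ord3 (V : nmodType) (f : 'I_3 -> V) (k l m : 'I_3) :
  k != l -> k != m -> l != m -> \sum_p f p = f k + f l + f m.
Proof.
move=> kl km lm; rewrite (bigD1 k) //= (bigD1 l) ?(eq_sym l) //=.
rewrite (bigD1 m) /=; last by rewrite !(eq_sym m) km lm.
rewrite [X in _ + (_ + (_ + X))]big_pred0 ?addr0 ?addrA // => p.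
by have /or3P[] := ord3_cover p kl km lm => ->; rewrite ?andbF.
Qed.

(** The unnormalized W-tensor, stated for general order so that a case with [d = 3] needs no
    transport between tensor types. *)
Definition Wsum (F : numFieldType) n d (a b : 'rV[F]_n) : tensor F n d :=
  \sum_(k < d) otimes (upd (fun=> a) k b).

(** * Symmetric sums of three strongly orthogonal terms *)

Section StrongToComplete.
Variables (R : realType) (F : numFieldType) (cj : F -> F) (re : F -> R).
Hypothesis hF : RorC cj re.
Variables (n d : nat).
Hypothesis d3 : (2 < d)%N.
Local Notation "<< v , w >>" := (dot cj v w).

(** Terms are indexed by the mode at which they are the odd one out. All factors off the diagonal
    are parallel to one [a], and symmetry makes the rescaled diagonal factors equal. *)
Lemma isolated_factors_Wsum (sigma : 'I_d -> F) (x : 'I_d -> 'I_d -> 'rV[F]_n)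
    (T := \sum_j sigma j *: otimes (x j)) :
  symmetric_tensors n d T ->
  (forall j, sigma j != 0) -> (forall j, rank_one (x j)) ->
  (forall j l, l != j -> <<x l j, x j j>> = 0) ->
  (forall j l m, l != j -> m != j -> parallel (x l j) (x m j)) ->
  exists a b, [/\ a != 0, b != 0, <<b, a>> = 0 & T = Wsum d a b].
Proof.
move=> symT s0 x1 isol par.
(* Move within term [l] to a mode [i] distinct from [l] and [l'], cross to term [l'] at that mode,
   and move on to [j']. *)
have offdiag l j l' j' : l != j -> l' != j' -> parallel (x l j) (x l' j').
  move=> lj lj'; have [i il il'] := exists_third l l' d3.
  have row p i1 i2 : p != i1 -> p != i2 -> parallel (x p i1) (x p i2).
    move=> pi1 pi2.
    apply: (isolated_term_parallel hF symT (s0 p) (x1 p) (j := p)).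
    - exact: isol.
    - by rewrite eq_sym.
    - by rewrite eq_sym.
  apply: parallel_trans (row l j i lj _) _; first by rewrite eq_sym.
  apply: parallel_trans (par i l l' _ _) (row l' i j' _ lj'); by rewrite eq_sym.
pose j0 : 'I_d := Ordinal (ltnW (ltnW d3)); pose j1 : 'I_d := Ordinal (ltnW d3).
have j01 : j0 != j1 by [].
pose a := x j0 j1; have a0 : a != 0 by exact: x1.
have /fin_all_exists2[c c0 xc] j : exists2 c, c != 0 &
    otimes (x j) = c *: otimes (upd (fun=> a) j (x j j)).
  apply: otimes_parallel => i; have [->|ij] := eqVneq i j.
    by rewrite upd_same; exact: parallel_refl.
  by rewrite upd_other //; apply: offdiag => //; rewrite eq_sym.
(* The odd factor absorbs all scalars, so that every coefficient becomes 1. *)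
pose b j := (sigma j * c j) *: x j j.
have ba j : <<b j, a>> = 0.
  have [l lj _] := exists_third j j d3; apply/eqP.
  have alj : parallel a (x l j) by apply: offdiag.
  rewrite dotZl mulf_eq0 (parallel_dotr hF _ alj) (dot_eq0C hF) isol //.
  by rewrite eqxx orbT.
have TE : T = \sum_j 1 *: otimes (upd (fun=> a) j (b j)).
  apply: eq_bigr => j _; rewrite scale1r otimes_updZ -scalerA.
  by congr (_ *: _); exact: xc.
have bb j j' : b j = b j'.
  have [->//|jj'] := eqVneq j j'; have j'j : j' != j by rewrite eq_sym.
  apply: (dot_inj hF) => u; move: symT; rewrite TE => symT'.
  (* With [a] tested at all modes but one, only the term whose odd mode carries [u] survives: [j] on
     the left, [j'] on the right. *)
  have := swap_sum hF (fun=> a) u a jj' symT'.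
  rewrite (bigD1 j) //= [X in _ + X]big1 ?addr0; last first.
    move=> l lj; have [->|lj'] := eqVneq l j'.
      by rewrite upd_same ba mulr0 mul0r mulr0.
    by rewrite (bigD1 l) /= ?lj ?lj' // upd_same ba mul0r !mulr0.
  rewrite [X in _ = X](bigD1 j') //= [X in _ = _ + X]big1 ?addr0; last first.
    move=> l lj; have [->|lj'] := eqVneq l j.
      by rewrite upd_same ba !mul0r mulr0.
    by rewrite (bigD1 l) /= ?lj ?lj' // upd_same ba mul0r !mulr0.
  rewrite !upd_same !upd_other // !mul1r.
  have rest l : l = j \/ l = j' ->
      \prod_(i | (i != j) && (i != j')) <<upd (fun=> a) l (b l) i, a>>
      = \prod_(i | (i != j) && (i != j')) <<a, a>>.
    move=> ll; apply: eq_bigr => i /andP[ij ij'].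
    by rewrite upd_other //; case: ll => ->.
  rewrite !rest; try by [left | right].
  have aa0 : <<a, a>> != 0 by rewrite (dotvv_eq0 hF).
  move/mulIf => /(_ _); rewrite [RHS]mulrC => E.
  apply/(mulIf aa0)/E.
  by apply/prodf_neq0 => i _.
exists a, (b j0); split=> //.
  by rewrite scaler_eq0 mulf_eq0 !negb_or s0 c0 x1.
by rewrite TE; apply: eq_bigr => j _; rewrite scale1r (bb j j0).
Qed.

(* If one term were the odd one out at two modes, testing T against the term x m
   and against x m with two factors exchanged would give different values. *)
Lemma repeated_isolation_absurd (I : finType) (sigma : I -> F)
    (x : I -> 'I_d -> 'rV[F]_n) (k l m : I) (j j' i : 'I_d) :
  symmetric_tensors n d (\sum_p sigma p *: otimes (x p)) ->
  (forall p, sigma p != 0) -> (forall p, rank_one (x p)) ->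
  (forall p, p != m -> p = k \/ p = l) -> m != k -> m != l ->
  j != j' -> i != j -> i != j' ->
  (forall p, p != k -> <<x p j, x k j>> = 0) ->
  (forall p, p != k -> <<x p j', x k j'>> = 0) ->
  (forall p, p != l -> <<x p i, x l i>> = 0) ->
  parallel (x m i) (x k i) -> False.
Proof.
move=> symT s0 x1 cover mk ml jj' ij ij' isolj isolj' isoli par.
(* The second isolating mode [j'] is used here, to compare the factors of term [k] at [i] and
   [j]. *)
have kpar : parallel (x k i) (x k j).
  exact: (isolated_term_parallel hF symT (s0 k) (x1 k) isolj').
have mpar : parallel (x m i) (x k j) by apply: parallel_trans kpar.
(* The left side reduces to the nonzero contribution of term [m]; on the right every term
   vanishes. *)
have := swap_sum hF (x m) (x m i) (x m j) ij symT.
rewrite (bigD1 m) //= [X in _ + X]big1 ?addr0; last first.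
  move=> p pm; case: (cover p pm) => ->.
    have /eqP -> : <<x k j, x m j>> == 0 by rewrite (dot_eq0C hF) isolj.
    by rewrite mulr0 mul0r mulr0.
  have /eqP -> : <<x l i, x m i>> == 0 by rewrite (dot_eq0C hF) isoli.
  by rewrite !mul0r mulr0.
rewrite [X in _ = X]big1 => [/eqP|p _].
  rewrite !mulf_eq0 !(negbTE (s0 m)) !(dotvv_eq0 hF) !(negbTE (x1 _ _)) /=.
  by apply/negP; apply/prodf_neq0 => h _; rewrite (dotvv_eq0 hF) x1.
have [->|pk] := eqVneq p k.
  have /eqP -> : <<x k i, x m j>> == 0.
    by rewrite (parallel_dot _ _ kpar) (dot_eq0C hF) isolj.
  by rewrite !mul0r mulr0.
have /eqP -> : <<x p j, x m i>> == 0.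
  by rewrite (parallel_dotr hF _ mpar) isolj.
by rewrite mulr0 mul0r mulr0.
Qed.

(** Mode [i] isolates every term, so within each term the factors at other modes are parallel.
    Parallelism of [k] and [l] at [j] then spreads to all modes but [i], where the two terms can be
    added. *)
Lemma merge_CON (sigma : 'I_3 -> F) (x : 'I_3 -> 'I_d -> 'rV[F]_n)
    (T := \sum_p sigma p *: otimes (x p)) (k l m : 'I_3) (i j : 'I_d) :
  symmetric_tensors n d T ->
  (forall p, sigma p != 0) -> (forall p, rank_one (x p)) ->
  k != l -> k != m -> l != m -> j != i ->
  (forall p q, p != q -> <<x p i, x q i>> = 0) ->
  parallel (x l j) (x k j) -> <<x k j, x m j>> = 0 ->
  CON cj n d 3 T.
Proof.
move=> symT s0 x1 kl km lm ji isol lk kmj; have lk' : l != k by rewrite eq_sym.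
have xpar p h h' : h != i -> h' != i -> parallel (x p h) (x p h').
  apply: (isolated_term_parallel hF symT (s0 p) (x1 p)) => q qp.
  exact: isol.
have [c c0 xl] : exists2 c, c != 0 &
    otimes (x l) = c *: otimes (upd (x k) i (x l i)).
  apply: otimes_parallel => h; have [->|hi] := eqVneq h i.
    by rewrite upd_same; exact: parallel_refl.
  rewrite upd_other //; apply: parallel_trans (xpar l h j hi ji) _.
  exact: parallel_trans lk (xpar k j h ji hi).
pose z := sigma k *: x k i + (sigma l * c) *: x l i.
have zE p :
    <<z, x p i>> = sigma k * <<x k i, x p i>> + sigma l * c * <<x l i, x p i>>.
  by rewrite dotDl !dotZl.
pose y := upd (x k) i z.
have y1 : rank_one y.
  move=> h; rewrite /y; have [->|hi] := eqVneq h i; last first.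
    by rewrite upd_other //; exact: x1.
  rewrite upd_same.
  (* Pairing [z] with [x k i] leaves only [sigma k] times a nonzero square norm. *)
  apply: contraNneq (s0 k) => z0; have := zE k.
  rewrite z0 dot0l (isol l k lk') mulr0 addr0 => /esym/eqP.
  by rewrite mulf_eq0 (dotvv_eq0 hF) (negbTE (x1 k i)) orbF.
have ym h : <<y h, x m h>> = 0.
  rewrite /y; have [->|hi] := eqVneq h i.
    by rewrite upd_same zE !isol // !mulr0 addr0.
  rewrite upd_other //; apply/eqP.
  by rewrite (parallel_dot _ _ (xpar k h j hi ji))
    (parallel_dotr hF _ (xpar m h j hi ji)) kmj.
have xk : x k =1 upd (x k) i (x k i).
  by move=> h; rewrite /upd; case: eqP => // ->.
exists 2%N => //.
exists (fun q : 'I_2 => if q == ord0 then 1 else sigma m).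
exists (fun q : 'I_2 => if q == ord0 then y else x m); split.
- by move=> q; case: eqP => _; [exact: y1 | exact: x1].
- move=> p q; have [p0|p0] := eqVneq p ord0;
    have [q0|q0] := eqVneq q ord0 => //=.
  + by rewrite p0 q0 eqxx.
  + by move=> _ h; apply/eqP; rewrite (dot_eq0C hF) ym.
  + by case: p p0 => [[|[]] ?] //; case: q q0 => [[|[]] ?].
- rewrite /T (sum_ord3 _ kl km lm) !big_ord_recl big_ord0 addr0 /= scale1r.
  congr (_ + _); rewrite /y otimes_updD !otimes_updZ -(otimes_ext xk).
  by rewrite xl scalerA.
Qed.

(** At each mode, failing to be orthogonal is an equivalence relation on the terms; the case split
    follows its classes. *)
Lemma SON3_symmetric (T : tensor F n d) :
  SON cj n d 3 T -> symmetric_tensors n d T ->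
  CON cj n d 3 T \/
  d = 3 /\ exists a b, [/\ a != 0, b != 0, <<b, a>> = 0 & T = Wsum d a b].
Proof.
move=> /nonzero_coefficients[s s3 [sigma [x [s0 x1 xo TE]]]] symT.
pose orth k l j := <<x k j, x l j>> == 0.
have orthC k l j : orth k l j = orth l k j by rewrite /orth (dot_eq0C hF).
have not_orth k l j : ~~ orth k l j -> parallel (x k j) (x l j).
  move=> klj; have [<-|kl] := eqVneq k l; first exact: parallel_refl.
  have [_ /(_ j)[kl0|//]] := xo k l kl.
  by rewrite /orth kl0 eqxx in klj.
have orth_par k l m j : ~~ orth k l j -> orth k m j = orth l m j.
  by move=> /not_orth; exact: parallel_dot.
have [co|] := boolP [forall k, forall l, (k != l) ==> [forall j, orth k l j]].
  left; exists s => //; exists sigma, x; split=> // k l kl j.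
  by move/forallP/(_ k)/forallP/(_ l): co => /implyP/(_ kl)/forallP/(_ j)/eqP.
case/forallPn => k /forallPn[l].
rewrite negb_imply => /andP[kl /forallPn[j klj]].
have [/existsP[i /forallP comm]|/existsPn distinct] :=
    boolP [exists i, forall p, ~~ orth p k i].
  left; have [c ->] : exists c, T = c *: tpow d (x k i).
    rewrite TE in symT *; apply: (common_factor_power hF symT (x1 k i)) => p.
    by apply: not_orth; exact: comm.
  exists 1%N => //; exists (fun=> c), (fun _ _ => x k i); split.
  - by move=> p h; exact: x1.
  - by move=> p q; rewrite !ord1.
  - by rewrite big_ord1.
(* Some term is orthogonal to [k] at mode [j]; it differs from [k], and from [l], which is not
   orthogonal to [k] there. *)
have s_eq3 : s = 3.
  have /forallPn[m] := distinct j; rewrite negbK => mkj.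
  have : uniq [:: k; l; m].
    rewrite /= !inE negb_or kl !andbT /=; apply/andP; split.
      by apply: contraTneq mkj => <-; rewrite /orth (dotvv_eq0 hF) x1.
    by apply: contraTneq mkj => <-; rewrite orthC.
  move/card_uniqP => E; apply/eqP; rewrite eqn_leq s3 /=.
  by have := max_card (mem [:: k; l; m]); rewrite E card_ord.
subst s; rewrite TE in symT *.
have third p q : p != q -> exists2 m : 'I_3, p != m & q != m.
  move=> pq; have [m mp mq] := @exists_third 3 p q isT.
  by exists m; rewrite eq_sym.
have [/existsP[i /forallP alli]|noi] := boolP [exists i, forall p, forall q,
    (p != q) ==> orth p q i].
  have isol p q : p != q -> <<x p i, x q i>> = 0.
    by move=> pq; have /forallP/(_ q)/implyP/(_ pq)/eqP := alli p.
  have [m km lm] := third k l kl; left.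
  have ji : j != i.
    by apply: contraNneq klj => ->; rewrite /orth isol.
  apply: (merge_CON symT s0 x1 kl km lm ji isol).
    by apply: not_orth; rewrite orthC.
  (* Otherwise no factor at [j] would be orthogonal to that of [k], against [distinct]. *)
  apply/eqP; apply/negPn/negP => kmj.
  have /forallPn[p] := distinct j; rewrite negbK => pkj.
  case/or3P: (ord3_cover p kl km lm) => /eqP E; move: pkj; rewrite E.
  - by rewrite /orth (dotvv_eq0 hF) (negbTE (x1 _ _)).
  - by rewrite orthC (negbTE klj).
  - by rewrite orthC /orth (negbTE kmj).
(* At every mode exactly two terms are parallel; [o i] is the remaining one. *)
have /fin_all_exists[o oP] i : exists m,
    (forall p, p != m -> <<x p i, x m i>> = 0) /\
    (forall p q, p != m -> q != m -> parallel (x p i) (x q i)).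
  move/existsPn/(_ i)/forallPn: noi => -[p /forallPn[q]].
  rewrite negb_imply => /andP[pq pqi]; have [m pm qm] := third p q pq.
  have pmi : orth p m i.
    have /forallPn[h] := distinct i; rewrite negbK => hki.
    apply: contraTT hki => pmi.
    have pall h' : ~~ orth p h' i.
      case/or3P: (ord3_cover h' pq pm qm) => /eqP -> //.
      by rewrite /orth (dotvv_eq0 hF) x1.
    by rewrite -(orth_par p h) ?pall.
  have qmi : orth q m i by rewrite -(orth_par p q).
  exists m; split=> [h hm|h h' hm h'm].
    apply/eqP; case/or3P: (ord3_cover h pq pm qm) hm => /eqP -> //.
    by rewrite eqxx.
  apply: not_orth; case/or3P: (ord3_cover h pq pm qm) hm => /eqP ->;
    case/or3P: (ord3_cover h' pq pm qm) h'm => /eqP -> //;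
    rewrite ?eqxx // => _ _.
  - by rewrite /orth (dotvv_eq0 hF) x1.
  - by rewrite orthC.
  - by rewrite /orth (dotvv_eq0 hF) x1.
(* If [o] is injective, there are at most three modes, and [o] reindexes the terms by their odd
   modes. *)
have [/injectiveP oinj|/injectivePn[i [i' ii' oii']]] := boolP (injectiveb o).
  right; have d_eq3 : d = 3.
    apply/eqP; rewrite eqn_leq d3 andbT.
    by have := leq_card o oinj; rewrite !card_ord.
  split=> //.
  have obij : bijective o by apply: inj_card_bij => //; rewrite !card_ord d_eq3.
  have E : \sum_k sigma k *: otimes (x k)
      = \sum_i (sigma \o o) i *: otimes ((x \o o) i).
    by rewrite (reindex o) //=; exact: onW_bij.
  rewrite E in symT *; apply: isolated_factors_Wsum symT _ _ _ _ => //=.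
  - by move=> h h' hh'; apply: (oP h).1; rewrite (inj_eq oinj).
  - by move=> h p q ph qh; apply: (oP h).2; rewrite (inj_eq oinj).
(* Here [o i] is odd at both [i] and [i']. The other two terms are orthogonal at some mode [h], so
   one of them is [o h], and the last term plays [m] in [repeated_isolation_absurd]. *)
have [p op _] := @exists_third 3 (o i) (o i) isT.
have [q oq pq] : exists2 q : 'I_3, q != o i & p != q.
  by have [q h1 h2] := third _ _ op; exists q => //; rewrite eq_sym.
have [h ph] : exists h, orth p q h.
  have [/eqP] := xo p q pq; rewrite (tdot_otimes hF).
  by case/prodf_eq0 => h _ ? _; exists h.
have oh : o h != o i.
  apply: contraTneq ph => oh.
  have := (oP h).2 p q; rewrite oh => /(_ op oq).
  exact: (dot_parallel_neq0 hF (x1 q h)).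
have absurd l' m' : l' != o i -> m' != o i -> l' != m' -> o h = l' -> False.
  move=> l'o m'o l'm' ohl'.
  have cover : forall r, r != m' -> r = o i \/ r = l'.
    move=> r rm; have ol : o i != l' by rewrite eq_sym.
    have om : o i != m' by rewrite eq_sym.
    case/or3P: (ord3_cover r ol om l'm') rm => /eqP ->;
      rewrite ?eqxx //; by [left | right].
  apply: (repeated_isolation_absurd symT s0 x1 cover m'o _ ii' (i := h)).
  - by rewrite eq_sym.
  - by apply: contraNneq oh => ->.
  - by apply: contraNneq oh => ->; rewrite oii'.
  - exact: (oP i).1.
  - by rewrite oii'; exact: (oP i').1.
  - by rewrite -ohl'; exact: (oP h).1.
  - by apply: (oP h).2; rewrite ohl' // eq_sym.
exfalso; have po : o i != p by rewrite eq_sym.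
have qo : o i != q by rewrite eq_sym.
case/or3P: (ord3_cover (o h) po qo pq) => /eqP E.
- by rewrite E eqxx in oh.
- exact: (absurd p q).
- by apply: (absurd q p) => //; rewrite eq_sym.
Qed.

End StrongToComplete.

(** * W-tensors of order three *)

Section OrderThree.
Variables (R : realType) (F : numFieldType) (cj : F -> F) (re : F -> R).
Hypothesis hF : RorC cj re.
Variable n : nat.
Implicit Types v w : 'rV[F]_n.
Local Notation "<< v , w >>" := (dot cj v w).

Lemma otimes3_Wsum v w :
  otimes3 v w w + otimes3 w v w + otimes3 w w v = Wsum 3 w v.
Proof.
rewrite /Wsum !big_ord_recl big_ord0 addr0 addrA /otimes3.
by congr (_ + _ + _); apply: otimes_ext => -[[|[|[|//]]] j3];
  rewrite (tnth_nth 0).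
Qed.

Lemma Wsum_symmetric d v w : symmetric_tensors n d (Wsum d w v).
Proof.
move=> s e; rewrite !sum_ffunE [RHS](reindex_perm s) /=.
apply: eq_bigr => k _; rewrite !ffunE [RHS](reindex_perm s) /=.
by apply: eq_bigr => j _; rewrite ffunE /upd (inj_eq perm_inj).
Qed.

Lemma W_symmetric (T : tensor F n 3) :
  W_tensors cj re n T -> symmetric_tensors n 3 T.
Proof.
case=> sigma [v [w [_ _ _ ->]]] s e; rewrite otimes3_Wsum ffunE [RHS]ffunE.
by rewrite Wsum_symmetric.
Qed.

(** Terms [k] and [l] have orthogonal factors at modes [k] and [l], and the same factor [w] at the
    remaining mode. *)
Lemma W_tensor_SON (T : tensor F n 3) : W_tensors cj re n T -> SON cj n 3 3 T.
Proof.
case=> sigma [v [w [vw v1 w1 ->]]]; rewrite otimes3_Wsum.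
have neq0 (u : 'rV[F]_n) : vnorm cj re u = 1 -> u != 0.
  move/eqP; rewrite (vnorm_eq1 hF) => /eqP u1.
  by rewrite -(dotvv_eq0 hF) u1 oner_eq0.
have wv : <<w, v>> = 0 by apply/eqP; rewrite (dot_eq0C hF) vw.
exists 3%N => //; exists (fun=> sigma), (fun k => upd (fun=> w) k v); split.
- by move=> k j; rewrite /upd; case: (j == k); exact: neq0.
- move=> k l kl; split.
    by rewrite (tdot_otimes hF) (bigD1 k) //= upd_same upd_other // vw mul0r.
  move=> j; have [->|jk] := eqVneq j k.
    by left; rewrite upd_same upd_other.
  rewrite upd_other //; have [->|jl] := eqVneq j l.
    by left; rewrite upd_same.
  by right; rewrite upd_other //; exact: parallel_refl.
- by rewrite /Wsum scaler_sumr.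
Qed.

Lemma Wsum_W_tensor (a b : 'rV[F]_n) : a != 0 -> b != 0 -> <<b, a>> = 0 ->
  W_tensors cj re n (Wsum 3 a b).
Proof.
move=> /(normalize hF)[s s0 s1] /(normalize hF)[t t0 t1] ba.
(* Each summand has one factor [b] and two factors [a], so this scalar undoes the normalization. *)
exists (t^-1 * (s^-1 * s^-1)), (t *: b), (s *: a); split.
- by rewrite dotZl (dotZr hF) ba !mulr0.
- by apply/eqP; rewrite (vnorm_eq1 hF) t1.
- by apply/eqP; rewrite (vnorm_eq1 hF) s1.
rewrite otimes3_Wsum /Wsum scaler_sumr; apply: eq_bigr => k _.
apply/ffunP => e; rewrite [RHS]ffunE !otimes_upd mxE.
under [X in _ = _ *: (_ * X)]eq_bigr do rewrite mxE.
rewrite big_split /= prodr_const cardC1 card_ord /=.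
move: (\prod_(j | j != k) _) (b 0 (e k)) => p q.
rewrite /GRing.scale /= expr2.
field; by rewrite s0 t0.
Qed.

End OrderThree.

(* F^n contains no three orthonormal vectors when n < 3, so for such n the
   orthonormal families on the right-hand sides have n members; for n >= 3,
   minn 3 n is 3. *)
Theorem theorem4p6 (R : realType) (F : numFieldType)
    (cj : F -> F) (re : F -> R) (hF : RorC cj re) (n : nat) :
  (forall d : nat, (3 < d)%N ->
     SON cj n d 3 `&` symmetric_tensors n d
       = CON cj n d 3 `&` symmetric_tensors n d /\
     CON cj n d 3 `&` symmetric_tensors n d
       = orthonormal_power_sums cj n d (minn 3 n)) /\
  SON cj n 3 3 `&` symmetric_tensors n 3
    = orthonormal_power_sums cj n 3 (minn 3 n) `|` W_tensors cj re n.
Proof.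
(* This equality holds from order three on and so serves both halves. *)
have powersE d : (2 < d)%N -> CON cj n d 3 `&` symmetric_tensors n d
    = orthonormal_power_sums cj n d (minn 3 n).
  move=> d3; apply/seteqP; split=> T.
    by case=> /(CON_symmetric_powers hF d3); apply.
  move=> powT; split; last first.
    have [sigma [v [_ ->]]] := powT.
    by apply: symmetric_sum => k; exact: tpow_symmetric.
  have [s sr H] := power_sum_CON hF (ltnW (ltnW d3)) powT.
  by exists s => //; apply: leq_trans sr (geq_minl _ _).
split=> [d d4|].
  split; last exact: powersE (ltnW d4).
  apply/seteqP; split=> T [sonT symT]; split=> //.
    have [//|[d_eq3]] := SON3_symmetric hF (ltnW d4) sonT symT.
    by rewrite d_eq3 in d4.
  by apply: (CON_SON hF) => //; exact: leq_trans d4.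
rewrite -powersE //; apply/seteqP; split=> T.
  case=> sonT symT; 
    have [conT|[_ [a [b [a0 b0 ba ->]]]]] :=
      SON3_symmetric hF (isT : (2 < 3)%N) sonT symT.
    by left.
  by right; exact: (Wsum_W_tensor hF).
case=> [[conT symT]|WT]; first by split=> //; apply: (CON_SON hF).
split; last exact: W_symmetric WT.
exact: (W_tensor_SON hF).
Qed.
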